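(* Let $(\mathbb V,\mathbb E,\mathbf P,\mathcal W)$ be a weighted Markovian graph satisfying assumptions (A) and (A$^*$) (see context). Then the matrix $\mathbf M^{(2)}$ of second moments of the weighted first passage times satisfies, for every $i\in\mathbb V$, $$\mathbf M^{(2)}(i,i)=\frac{\boldsymbol\pi(\mathbf P\circ\mathbf W^{(2)})\mathbf 1+\big(2\boldsymbol\pi(\mathbf P\circ\mathbf W)(\mathbf M-[\mathbf M]_{\mathrm{dg}})\big)(i)}{\boldsymbol\pi(i)},$$ and $$\begin{aligned}\mathbf M^{(2)}={}&\mathbf Z(\mathbf P\circ\mathbf W^{(2)})\mathbf 1\mathbf 1^\top-\mathbf 1\mathbf 1^\top\big[\mathbf Z(\mathbf P\circ\mathbf W^{(2)})\mathbf 1\mathbf 1^\top\big]_{\mathrm{dg}}\\&+2\Big(\mathbf Z(\mathbf P\circ\mathbf W)(\mathbf M-[\mathbf M]_{\mathrm{dg}})-\mathbf 1\mathbf 1^\top\big[\mathbf Z(\mathbf P\circ\mathbf W)(\mathbf M-[\mathbf M]_{\mathrm{dg}})\big]_{\mathrm{dg}}\Big)\\&+\big(\mathbf I-\mathbf Z+\mathbf 1\mathbf 1^\top[\mathbf Z]_{\mathrm{dg}}\big)[\mathbf M^{(2)}]_{\mathrm{dg}}.\end{aligned}$$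
   Context: Weighted Markovian graph $(\mathbb V,\mathbb E,\mathbf P,\mathcal W)$: $\mathbb V=\{1,\dots,n\}$; $\mathbb E\subseteq\mathbb V\times\mathbb V$; the graph is strongly connected; $\mathbf P$ is a row-stochastic $n\times n$ matrix with $\mathbf P(i,j)\ge 0$ for $(i,j)\in\mathbb E$ and $\mathbf P(i,j)=0$ otherwise, assumed irreducible and (unless otherwise stated) aperiodic. The weights $\mathcal W(i,j)$ (random, or deterministic as a special case) take values in $[\epsilon,\infty)$ for $(i,j)\in\mathbb E$, for some $\epsilon>0$, and are zero otherwise. Assumption (A): $\mathbf P$ has a unique stationary distribution $\boldsymbol\pi$ (a row vector), and $\mathbf W(i,j)=\mathbb E[\mathcal W(i,j)]<\infty$, $\mathbf W^{(2)}(i,j)=\mathbb E[\mathcal W(i,j)^2]<\infty$ for $(i,j)\in\mathbb E$. Assumption (A$^*$): the weight matrices $(\mathcal W(i,j;m))_{i,j}$, $m\ge1$, used at successive transitions $m=1,2,\dots$ are i.i.d. (with the law of $\mathcal W$); they are independent of the chain. Let $(\hat X_k)_{k\ge0}$ be the Markov chain with transition matrix $\mathbf P$. For $\hat X_0=i$ let $\hat\tau(i,j)=\inf\{m\ge1:\hat X_m=j\}$ (first return time if $i=j$) and $\tau(i,j)=\sum_{m=1}^{\hat\tau(i,j)}\mathcal W(\hat X_{m-1},\hat X_m;m)$. Set $\mathbf M(i,j)=\mathbb E[\tau(i,j)]$ and $\mathbf M^{(2)}(i,j)=\mathbb E[\tau(i,j)^2]$. Notation: $\circ$ is the entrywise product;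 $\mathbf 1$ is the all-ones column vector; $[\cdot]_{\mathrm{dg}}$ sets all off-diagonal entries of a matrix to zero; $\Pi=\mathbf 1\boldsymbol\pi$; $\mathbf Z=(\mathbf I-\mathbf P+\Pi)^{-1}$. *)

(* Defs.v *)
From HB Require Import structures.
From mathcomp Require Export all_boot all_order all_algebra.
From mathcomp Require Export all_classical all_reals all_analysis.
Set Implicit Arguments.
Unset Strict Implicit.
Unset Printing Implicit Defensive.
Import Order.TTheory GRing.Theory Num.Theory.
Import numFieldNormedType.Exports.
Local Open Scope classical_set_scope.
Local Open Scope ring_scope.

Definition hadamard (R : realType) (n : nat) (A B : 'M[R]_n) : 'M[R]_n :=
  map2_mx *%R A B.

Definition dg (R : realType) (n : nat) (A : 'M[R]_n) : 'M[R]_n :=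
  \matrix_(i, j) (if i == j then A i j else 0).

Definition ones (R : realType) (n : nat) : 'cV[R]_n := const_mx 1.
Arguments ones {R n}.

Definition strongly_connected (n : nat) (e : rel 'I_n) : Prop :=
  forall i j, connect e i j.

Definition markovian (R : realType) (n : nat) (e : rel 'I_n) (P : 'M[R]_n) :
    Prop :=
  [/\ forall i j, e i j -> 0 <= P i j,
      forall i j, ~~ e i j -> P i j = 0 &
      forall i, \sum_j P i j = 1].

Definition irreducible_mx (R : realType) (n : nat) (P : 'M[R]_n) : Prop :=
  forall i j, exists2 k : nat, (0 < k)%N & 0 < (P ^+ k) i j.

(* The gcd of the possible return lengths is 1: their only common divisor
   is 1. *)
Definition aperiodic_mx (R : realType) (n : nat) (P : 'M[R]_n) : Prop :=
  forall (i : 'I_n) (c : nat),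
    (forall k : nat, (0 < k)%N -> 0 < (P ^+ k) i i -> (c %| k)%N) -> c = 1%N.

Definition stationary (R : realType) (n : nat) (P : 'M[R]_n) (p : 'rV[R]_n) :
    Prop :=
  [/\ forall i, 0 <= p 0 i, \sum_i p 0 i = 1 & p *m P = p].

Definition weight_values (R : realType) (n : nat) (e : rel 'I_n) (eps : R)
    (A : 'M[R]_n) : Prop :=
  (forall i j, e i j -> eps <= A i j) /\ (forall i j, ~~ e i j -> A i j = 0).

(* The product sigma-algebra on n x n real matrices. *)
Definition mx_borel (R : realType) (n : nat) : set (set 'M[R]_n) :=
  <<s [set C | exists i j, exists2 B : set R,
         measurable B & C = [set A : 'M[R]_n | B (A i j)]] >>.
Arguments mx_borel {R n}.

Definition random_mx d (T : measurableType d) (R : realType) (n : nat)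
    (W : T -> 'M[R]_n) : Prop :=
  forall i j, measurable_fun [set: T] (fun w => W w i j).

Definition same_law d (T : measurableType d) (R : realType)
    (Pr : probability T R) (n : nat) (W W' : T -> 'M[R]_n) : Prop :=
  forall B, mx_borel B -> Pr (W @^-1` B) = Pr (W' @^-1` B).

Definition independent_mxs d (T : measurableType d) (R : realType)
    (Pr : probability T R) (n : nat) (W : nat -> T -> 'M[R]_n) : Prop :=
  forall (s : seq nat) (B : nat -> set 'M[R]_n),
    uniq s -> (forall m, m \in s -> (0 < m)%N) ->
    (forall m, mx_borel (B m)) ->
    fine (Pr (\bigcap_(m in [set` s]) (W m @^-1` B m))) =
    \prod_(m <- s) fine (Pr (W m @^-1` B m)).

(* Transitions are numbered from 1, so the matrix [W 0] is never used and
   nothing is required of it. *)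
Definition iid_weights d (T : measurableType d) (R : realType)
    (Pr : probability T R) (n : nat) (W0 : T -> 'M[R]_n)
    (W : nat -> T -> 'M[R]_n) : Prop :=
  [/\ forall m, (0 < m)%N -> random_mx (W m),
      forall m, (0 < m)%N -> same_law Pr (W m) W0 &
      independent_mxs Pr W].

Definition cond_prob d (T : measurableType d) (R : realType)
    (Pr : probability T R) (A B : set T) : R :=
  fine (Pr (A `&` B)) / fine (Pr B).

Definition markov_chain d (T : measurableType d) (R : realType)
    (Pr : probability T R) (n : nat) (P : 'M[R]_n) (i : 'I_n)
    (X : nat -> T -> 'I_n) : Prop :=
  [/\ forall k j, measurable [set w | X k w = j],
      Pr [set w | X 0%N w = i] = 1%E &
      forall (k : nat) (x : nat -> 'I_n) (j : 'I_n),
        let past := [set w | forall l, (l <= k)%N -> X l w = x l] in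
        Pr past != 0%E ->
        cond_prob Pr [set w | X k.+1 w = j] past = P (x k) j].

Definition chain_events (T : Type) (n : nat) (X : nat -> T -> 'I_n) :
    set (set T) :=
  <<s [set A | exists k j, A = [set w | X k w = j]] >>.

Definition weight_events (T : Type) (R : realType) (n : nat)
    (W : nat -> T -> 'M[R]_n) : set (set T) :=
  <<s [set A | exists2 m : nat, (0 < m)%N &
         exists2 B, mx_borel B & A = W m @^-1` B] >>.

Definition independent_of_chain d (T : measurableType d) (R : realType)
    (Pr : probability T R) (n : nat) (X : nat -> T -> 'I_n)
    (W : nat -> T -> 'M[R]_n) : Prop :=
  forall A B, chain_events X A -> weight_events W B ->
    Pr (A `&` B) = (Pr A * Pr B)%E.

(* [+oo] if [j] is never reached, as the infimum of the empty set. *)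
Definition hat_tau (R : realType) (T : Type) (n : nat) (X : nat -> T -> 'I_n)
    (j : 'I_n) (w : T) : \bar R :=
  ereal_inf [set m%:R%:E | m in [set m : nat | (0 < m)%N /\ X m w = j]].

Definition tau (R : realType) (T : Type) (n : nat) (X : nat -> T -> 'I_n)
    (W : nat -> T -> 'M[R]_n) (j : 'I_n) (w : T) : \bar R :=
  (\sum_(1 <= m <oo | m%:R%:E <= hat_tau R X j w)
     (W m w (X m.-1 w) (X m w))%:E)%E.

(* [X i] is the chain started at [i]. *)
Definition passage_moment d (T : measurableType d) (R : realType)
    (Pr : probability T R) (n : nat) (X : 'I_n -> nat -> T -> 'I_n)
    (W : nat -> T -> 'M[R]_n) (r : nat) (i j : 'I_n) : \bar R :=
  (\int[Pr]_w (tau (X i) W j w ^+ r))%E.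

Definition passage_moment_mx d (T : measurableType d) (R : realType)
    (Pr : probability T R) (n : nat) (X : 'I_n -> nat -> T -> 'I_n)
    (W : nat -> T -> 'M[R]_n) (r : nat) : 'M[R]_n :=
  \matrix_(i, j) fine (passage_moment Pr X W r i j).

Definition weight_moment d (T : measurableType d) (R : realType)
    (Pr : probability T R) (n : nat) (W0 : T -> 'M[R]_n) (r : nat)
    (i j : 'I_n) : \bar R :=
  ('E_Pr[fun w => ((W0 w i j) ^+ r)%R])%E.

Definition weight_moment_mx d (T : measurableType d) (R : realType)
    (Pr : probability T R) (n : nat) (W0 : T -> 'M[R]_n) (r : nat) : 'M[R]_n :=
  \matrix_(i, j) fine (weight_moment Pr W0 r i j).

Definition limit_mx (R : realType) (n : nat) (p : 'rV[R]_n) : 'M[R]_n :=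
  ones *m p.

Definition fundamental_mx (R : realType) (n : nat) (P : 'M[R]_n)
    (p : 'rV[R]_n) : 'M[R]_n :=
  invmx (1%:M - P + limit_mx p).

(* Main.v *)
From HB Require Import structures.
Require Import Defs.
From mathcomp Require Import measurable_realfun.
From mathcomp Require Import lra ring.
Import Order.TTheory GRing.Theory Num.Theory.
Import numFieldNormedType.Exports.
Local Open Scope classical_set_scope.
Local Open Scope ring_scope.
Set Implicit Arguments.
Unset Strict Implicit.
Unset Printing Implicit Defensive.

(** Fix the target [j], and let [W1], [W2] be the entrywise first and second
    moments of the weights. Splitting a passage to [j] at its first step, from
    [i] to [b], gives tau = w + c tau', where w is the first weight, c is 1 if
    [b] differs from [j] and 0 otherwise, and tau' is a passage from [b] whose
    weights are independent of w. Squaring and taking expectations,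
    $$ M2(i,j) = sum_b P(i,b) (W2(i,b)
                   + [b <> j] (2 W1(i,b) M(b,j) + M2(b,j))), $$
    that is, M2 = A + P (M2 - [M2]_dg) with
    A = (P o W2) 1 1^T + 2 (P o W1) (M - [M]_dg). Multiplying by the stationary
    row vector cancels M2 and leaves the diagonal of M2 ([first_step_diag]).
    Multiplying by Z, with Z (I - P) = I - 1 pi ([fundamental_mul]), determines
    M2 up to a matrix with constant columns, and that matrix is read off the
    diagonal ([first_step_solution]). Here Z exists because a harmonic vector of
    an irreducible chain is constant.

    The recurrence for M2 has content only once M and M2 are known to be finite.
    Both facts come from truncation. Let S_N be the length of the walk stopped at
    [j] or after N steps ([stopped_length]). Its moments satisfy the first-step
    recurrences with N on the left and N - 1 on the right. This is proved by
    integrating over a cylinder, the event that the chain has followed a given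
    path so far, and splitting the cylinder according to the next state
    ([integral_stopped_length], [integral_stopped_length2]): on cylinders the
    Markov property is the hypothesis itself, and the weights factor out by
    independence ([integral_chain_weights], [integral_weight_mul], both instances
    of [integral_mul_indep]). The recurrences have the form v_(N+1) = h_N + Q v_N
    with Q the matrix P whose column [j] is erased. Irreducibility makes Q^K
    strictly substochastic for some K, hence there is a finite y with
    H + Q y <= y ([taboo_supersolution]), which dominates every v_N when H bounds
    the h_N. So the moments of S_N converge, and the limit satisfies the limit
    recurrence ([taboo_iteration_cvg]); by monotone convergence the limit is the
    moment of tau ([cvg_passage_moment]). *)

(** * Expectations *)

Section expectations.
Context d (T : measurableType d) (R : realType).
Variable Pr : probability T R.

(** The joint law of independent variables is the product of their laws, so the
    expectation of the product splits by Tonelli. *)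
Lemma integral_mul_indep (U V : T -> R) :
    measurable_fun setT U -> measurable_fun setT V ->
    (forall w, 0 <= U w) -> (forall w, 0 <= V w) ->
    (forall A B : set R, measurable A -> measurable B ->
      Pr (U @^-1` A `&` V @^-1` B) = (Pr (U @^-1` A) * Pr (V @^-1` B))%E) ->
  (\int[Pr]_w (U w * V w)%:E
     = \int[Pr]_w (U w)%:E * \int[Pr]_w (V w)%:E)%E.
Proof.
move=> mU mV U0 V0 UV.
pose U' : {mfun T >-> R} := HB.pack U (isMeasurableFun.Build _ _ _ _ U mU).
pose V' : {mfun T >-> R} := HB.pack V (isMeasurableFun.Build _ _ _ _ V mV).
pose H := fun w => (U w, V w).
have mH : measurable_fun setT H by exact: measurable_fun_pair.
pose H' : {mfun T >-> (R * R)%type} :=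
  HB.pack H (isMeasurableFun.Build _ _ _ _ H mH).
(* Tonelli asks for an integrand that is nonnegative on the whole plane; the
   absolute values change nothing on the range of [U] and [V]. *)
pose f (z : R * R) : \bar R := (`|z.1| * `|z.2|)%:E.
have mn : measurable_fun setT (fun x : R => `|x|%:E).
  by apply/measurable_EFinP; exact: normr_measurable.
have mf : measurable_fun setT f.
  apply/measurable_EFinP; apply: measurable_funM.
    by apply: (measurableT_comp (@normr_measurable R setT)); exact: measurable_fst.
  by apply: (measurableT_comp (@normr_measurable R setT)); exact: measurable_snd.
have f0 z : (0 <= f z)%E by rewrite lee_fin mulr_ge0.
transitivity (\int[distribution Pr H']_z f z)%E.
  rewrite ge0_integral_distribution//.
  by apply: eq_integral => w _ /=; rewrite /f /= !ger0_norm.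
transitivity (\int[distribution Pr U' \x distribution Pr V']_z f z)%E.
  apply: eq_measure_integral => A mA _; apply/esym.
  by apply: product_measure_unique.
rewrite fubini_tonelli1// /fubini_F.
have -> : (\int[Pr]_w (U w)%:E = \int[distribution Pr U']_x `|x|%:E)%E.
  rewrite ge0_integral_distribution//.
  by apply: eq_integral => w _ /=; rewrite ger0_norm.
have -> : (\int[Pr]_w (V w)%:E = \int[distribution Pr V']_x `|x|%:E)%E.
  rewrite ge0_integral_distribution//.
  by apply: eq_integral => w _ /=; rewrite ger0_norm.
rewrite -ge0_integralZr//; last by apply: integral_ge0 => x _; rewrite lee_fin.
apply: eq_integral => x _.
rewrite -ge0_integralZl//.
Qed.

Lemma eq_law_integral (U V : T -> R) :
    measurable_fun setT U -> measurable_fun setT V ->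
    (forall w, 0 <= U w) -> (forall w, 0 <= V w) ->
    (forall A : set R, measurable A -> Pr (U @^-1` A) = Pr (V @^-1` A)) ->
  (\int[Pr]_w (U w)%:E = \int[Pr]_w (V w)%:E)%E.
Proof.
move=> mU mV U0 V0 UV.
pose U' : {mfun T >-> R} := HB.pack U (isMeasurableFun.Build _ _ _ _ U mU).
pose V' : {mfun T >-> R} := HB.pack V (isMeasurableFun.Build _ _ _ _ V mV).
have mn : measurable_fun setT (fun x : R => `|x|%:E).
  by apply/measurable_EFinP; exact: normr_measurable.
transitivity (\int[distribution Pr U']_x `|x|%:E)%E.
  rewrite ge0_integral_distribution//.
  by apply: eq_integral => w _ /=; rewrite ger0_norm.
transitivity (\int[distribution Pr V']_x `|x|%:E)%E.
  by apply: eq_measure_integral => A mA _; exact: UV.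
rewrite ge0_integral_distribution//.
by apply: eq_integral => w _ /=; rewrite ger0_norm.
Qed.

Lemma ge0_integralDZ (A : set T) (f g : T -> R) (c : R) :
    measurable A -> measurable_fun setT f -> measurable_fun setT g ->
    (forall w, 0 <= f w) -> (forall w, 0 <= g w) -> 0 <= c ->
  (\int[Pr]_(w in A) (f w + c * g w)%:E
     = \int[Pr]_(w in A) (f w)%:E + c%:E * \int[Pr]_(w in A) (g w)%:E)%E.
Proof.
move=> mA mf mg f0 g0 c0.
have mf' : measurable_fun A (EFin \o f).
  by apply: measurable_funTS; exact/measurable_EFinP.
have mg' : measurable_fun A (EFin \o g).
  by apply: measurable_funTS; exact/measurable_EFinP.
under eq_integral do rewrite EFinD EFinM.
rewrite ge0_integralD//.
- by rewrite ge0_integralZl// => w _; rewrite lee_fin.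
- by move=> w _; rewrite lee_fin.
- by move=> w _; rewrite lee_fin mulr_ge0.
- by apply: measurable_funeM.
Qed.

(** For reading a weight matrix at a random entry: a sum over the finitely many
    values of the index. *)
Lemma measurable_fun_pick n (Y : T -> 'I_n) (F : 'I_n -> T -> R) :
    (forall a, measurable [set w | Y w = a]) ->
    (forall a, measurable_fun setT (F a)) ->
  measurable_fun setT (fun w => F (Y w) w).
Proof.
move=> mY mF.
have -> : (fun w => F (Y w) w) =
    (fun w => \sum_(a <- enum 'I_n) \1_[set w | Y w = a] w * F a w).
  apply/funext => w; rewrite big_enum /= (bigD1 (Y w))//= big1 => [|a aY].
    by rewrite indicE mem_set// mul1r addr0.
  by rewrite indicE memNset ?mul0r//= => /esym/eqP; rewrite (negbTE aY).
apply: measurable_sum => a.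
apply: measurable_funM => //; exact: measurable_indic.
Qed.

End expectations.

(** * Moments of truncated walks *)

(** The recursion peels the first step off, so that a first-step analysis needs no
    shift of the probability space: the length still to be walked is again a
    [stopped_length], with the index [k] moved on. *)
Fixpoint stopped_length (R : realType) (T : Type) (n : nat)
    (X : nat -> T -> 'I_n) (W : nat -> T -> 'M[R]_n) (j : 'I_n)
    (k N : nat) (w : T) : R :=
  if N is N'.+1 then
    W k.+1 w (X k w) (X k.+1 w)
    + (X k.+1 w != j)%:R * stopped_length X W j k.+1 N' w
  else 0.

(** The expectation of [stopped_length] for a walk that stands at [a], as given by
    its first-step recurrence. *)
Fixpoint mean_stopped (R : realType) (n : nat) (P W1 : 'M[R]_n) (j : 'I_n)
    (N : nat) (a : 'I_n) : R :=
  if N is N'.+1 then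
    \sum_b P a b * (W1 a b + (b != j)%:R * mean_stopped P W1 j N' b)
  else 0.

(** Likewise for the square: with [c] equal to 0 or 1, the square of [w + c * s] is
    [w ^+ 2 + c * (s ^+ 2 + 2 * (w * s))]. *)
Fixpoint mean2_stopped (R : realType) (n : nat) (P W1 W2 : 'M[R]_n) (j : 'I_n)
    (N : nat) (a : 'I_n) : R :=
  if N is N'.+1 then
    \sum_b P a b * (W2 a b
      + (b != j)%:R * (mean2_stopped P W1 W2 j N' b
                       + 2 * (W1 a b * mean_stopped P W1 j N' b)))
  else 0.

Definition cylinder (T : Type) (n : nat) (X : nat -> T -> 'I_n)
    (x : nat -> 'I_n) (k : nat) : set T :=
  [set w | forall l, (l <= k)%N -> X l w = x l].

Definition extend (n : nat) (x : nat -> 'I_n) (k : nat) (b : 'I_n) (l : nat) :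
    'I_n :=
  if (l <= k)%N then x l else b.

Section cylinders.
Context (T : pointedType) (n : nat).
Variable X : nat -> T -> 'I_n.

(** In this form the cylinder is the event that the Markov property speaks of. *)
Lemma cylinder_extend x k b :
  cylinder X (extend x k b) k.+1 = [set w | X k.+1 w = b] `&` cylinder X x k.
Proof.
apply/seteqP; split => [w Xw|w [/= Xb Xw] l].
  split=> [|l lk] /=; first by rewrite (Xw k.+1 (leqnn _)) /extend ltnn.
  by rewrite (Xw l (leqW lk)) /extend lk.
rewrite leq_eqVlt => /predU1P[->|]; rewrite /extend ?ltnn// ltnS => lk.
by rewrite lk Xw.
Qed.

Lemma cylinder_split x k :
  cylinder X x k = \big[setU/set0]_(b <- enum 'I_n) cylinder X (extend x k b) k.+1.
Proof.
rewrite -bigcup_seq; apply/seteqP; split => [w Xw|w [b _]].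
  by exists (X k.+1 w); rewrite ?cylinder_extend//= mem_enum.
by rewrite cylinder_extend => -[].
Qed.

Lemma chain_events_cylinder x k : chain_events X (cylinder X x k).
Proof.
pose G := [set A | exists k j, A = [set w | X k w = j]].
suff : @measurable _ (g_sigma_algebraType G) (cylinder X x k) by [].
elim: k => [|k IH].
  have -> : cylinder X x 0 = [set w | X 0%N w = x 0%N].
    by apply/seteqP; split => [w Xw|w /= Xw l]; [exact: Xw|rewrite leqn0 => /eqP ->].
  by apply: sub_sigma_algebra; exists 0%N, (x 0%N).
have -> : cylinder X x k.+1 = [set w | X k.+1 w = x k.+1] `&` cylinder X x k.
  apply/seteqP; split => [w Xw|w [/= Xb Xw] l].
    by split=> [|l lk] /=; apply: Xw => //; exact: leqW.
  by rewrite leq_eqVlt => /predU1P[->//|/Xw].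
by apply: measurableI => //; apply: sub_sigma_algebra; exists k.+1, (x k.+1).
Qed.

End cylinders.

Section walk.
Context d (T : measurableType d) (R : realType).
Variable Pr : probability T R.
Variables (n : nat) (P : 'M[R]_n) (i : 'I_n) (X : nat -> T -> 'I_n).
Hypothesis hX : markov_chain Pr P i X.

Lemma measurable_chain_events A : chain_events X A -> measurable A.
Proof.
have [mX _ _] := hX.
suff : chain_events X `<=` @measurable _ T by apply.
apply: smallest_sub; first exact: sigma_algebra_measurable.
by move=> _ [k [j ->]]; exact: mX.
Qed.

Lemma measurable_cylinder x k : measurable (cylinder X x k).
Proof. by apply: measurable_chain_events; exact: chain_events_cylinder. Qed.

Lemma probability_cylinder_extend x k b :
  Pr (cylinder X (extend x k b) k.+1)
  = ((P (x k) b)%:E * Pr (cylinder X x k))%E.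
Proof.
have [mX _ markov] := hX.
rewrite cylinder_extend.
have mI : measurable ([set w | X k.+1 w = b] `&` cylinder X x k).
  by apply: measurableI => //; exact: measurable_cylinder.
have [p0|p0] := eqVneq (Pr (cylinder X x k)) 0%E.
  rewrite p0 mule0; apply/eqP; rewrite -measure_le0 -p0.
  apply: le_measure; rewrite ?inE//; first exact: measurable_cylinder.
have := markov k x b p0; rewrite /cond_prob -/(cylinder X x k) => <-.
have fin_cyl := fin_num_measure Pr _ (measurable_cylinder x k).
rewrite -(fineK fin_cyl) -EFinM divfK ?fineK//; first exact: fin_num_measure.
by apply: contra p0 => /eqP p0; rewrite -(fineK fin_cyl) p0.
Qed.

Lemma integral_cylinder_split (f : T -> R) x k :
    measurable_fun setT f -> (forall w, 0 <= f w) ->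
  (\int[Pr]_(w in cylinder X x k) (f w)%:E
   = \sum_b \int[Pr]_(w in cylinder X (extend x k b) k.+1) (f w)%:E)%E.
Proof.
move=> mf f0; rewrite cylinder_split ge0_integral_bigsetU//.
- by rewrite big_enum.
- by move=> b; exact: measurable_cylinder.
- exact: enum_uniq.
- move=> b c _ _ [w []]; rewrite !cylinder_extend => -[/= <- _] [/= <- _] //.
- by apply: measurable_funTS; exact/measurable_EFinP.
- by move=> w _; rewrite lee_fin.
Qed.

Variables (W : nat -> T -> 'M[R]_n) (W1 W2 : 'M[R]_n) (j : 'I_n).
Hypothesis W_ge0 : forall m w a b, (0 < m)%N -> 0 <= W m w a b.
Hypothesis mW : forall m, (0 < m)%N -> random_mx (W m).

Lemma stopped_length_ge0 k N w : 0 <= stopped_length X W j k N w.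
Proof.
by elim: N k => //= N IH k; rewrite addr_ge0 ?W_ge0// mulr_ge0.
Qed.

Lemma measurable_stopped_length k N :
  measurable_fun setT (stopped_length X W j k N).
Proof.
have [mX _ _] := hX.
elim: N k => [|N IH] k /=; first exact: measurable_cst.
apply: measurable_funD.
  apply: (measurable_fun_pick (F := fun a w => W k.+1 w a (X k.+1 w))) => // a.
  by apply: (measurable_fun_pick (F := fun b w => W k.+1 w a b)) => // b; exact: mW.
apply: measurable_funM => //.
apply: (measurable_fun_pick (F := fun b _ => (b != j)%:R : R)) => // b.
Qed.

(** With [U] the constant 1 this is the first moment. With [U] the weight of an
    earlier step it is the cross term of the second moment; hence the factor
    [U], which is carried through the induction unchanged. *)
Lemma integral_stopped_length (U : T -> R) (u : R) k N x :
    measurable_fun setT U -> (forall w, 0 <= U w) ->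
    (forall A m a b, chain_events X A -> (k < m)%N ->
      (\int[Pr]_(w in A) (U w * W m w a b)%:E = (u * W1 a b)%:E * Pr A)%E) ->
  (\int[Pr]_(w in cylinder X x k) (U w * stopped_length X W j k N w)%:E
   = (u * mean_stopped P W1 j N (x k))%:E * Pr (cylinder X x k))%E.
Proof.
move=> mU U0; elim: N k x => [|N IH] k x UW /=.
  by under eq_integral do rewrite mulr0; rewrite integral0 mulr0 mul0e.
have mS := measurable_stopped_length.
rewrite integral_cylinder_split; last 2 first.
- by apply: measurable_funM => //; exact: (mS k N.+1).
- by move=> w; rewrite mulr_ge0//; exact: (stopped_length_ge0 k N.+1).
have [p pE] : exists p, Pr (cylinder X x k) = p%:E.
  exists (fine (Pr (cylinder X x k))); rewrite fineK//.
  exact/fin_num_measure/measurable_cylinder.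
rewrite pE -EFinM mulr_sumr mulr_suml -sumEFin.
apply: eq_bigr => b _.
pose f w := U w * W k.+1 w (x k) b.
pose g w := U w * stopped_length X W j k.+1 N w.
rewrite (eq_integral (fun w => (f w + (b != j)%:R * g w)%:E)); last first.
  move=> w; rewrite inE cylinder_extend => -[/= -> Xw].
  by rewrite Xw// /f /g; congr EFin; ring.
rewrite ge0_integralDZ//; last 5 first.
- exact: measurable_cylinder.
- by apply: measurable_funM => //; exact: mW.
- exact: measurable_funM.
- by move=> w; rewrite mulr_ge0// W_ge0.
- by move=> w; rewrite mulr_ge0// stopped_length_ge0.
rewrite UW//; last exact: chain_events_cylinder.
rewrite IH; last by move=> A m a c cA km; apply: UW => //; exact: ltnW.
rewrite /extend ltnn -/(extend x k b) probability_cylinder_extend pE.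
by rewrite -!EFinM -EFinD; congr EFin; ring.
Qed.

Hypothesis integral_weight : forall A m a b, chain_events X A -> (0 < m)%N ->
  (\int[Pr]_(w in A) (W m w a b)%:E = (W1 a b)%:E * Pr A)%E.
Hypothesis integral_weight2 : forall A m a b, chain_events X A -> (0 < m)%N ->
  (\int[Pr]_(w in A) (W m w a b ^+ 2)%:E = (W2 a b)%:E * Pr A)%E.
Hypothesis integral_weight_mul : forall A l m a b a' b', chain_events X A ->
  (0 < l < m)%N ->
  (\int[Pr]_(w in A) (W l w a b * W m w a' b')%:E
   = (W1 a b * W1 a' b')%:E * Pr A)%E.

Lemma integral_stopped_length1 k N x :
  (\int[Pr]_(w in cylinder X x k) (stopped_length X W j k N w)%:E
   = (mean_stopped P W1 j N (x k))%:E * Pr (cylinder X x k))%E.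
Proof.
rewrite -[mean_stopped _ _ _ _ _]mul1r -(@integral_stopped_length (cst 1))//.
- by apply: eq_integral => w _; rewrite mul1r.
- move=> A m a b cA km; rewrite mul1r.
  rewrite -(integral_weight (m := m))//; last exact: leq_ltn_trans km.
  by apply: eq_integral => w _; rewrite mul1r.
Qed.

Lemma integral_stopped_length2 k N x :
  (\int[Pr]_(w in cylinder X x k) (stopped_length X W j k N w ^+ 2)%:E
   = (mean2_stopped P W1 W2 j N (x k))%:E * Pr (cylinder X x k))%E.
Proof.
elim: N k x => [|N IH] k x /=.
  by under eq_integral do rewrite expr0n /=; rewrite integral0 mul0e.
have mS := measurable_stopped_length.
rewrite integral_cylinder_split; last 2 first.
- exact/measurable_funX/(mS k N.+1).
- by move=> w; rewrite exprn_ge0//; exact: (stopped_length_ge0 k N.+1).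
have [p pE] : exists p, Pr (cylinder X x k) = p%:E.
  exists (fine (Pr (cylinder X x k))); rewrite fineK//.
  exact/fin_num_measure/measurable_cylinder.
rewrite pE -EFinM mulr_suml -sumEFin.
apply: eq_bigr => b _.
pose V w := W k.+1 w (x k) b.
pose S w := stopped_length X W j k.+1 N w.
rewrite (eq_integral (fun w =>
    (V w ^+ 2 + (b != j)%:R * (S w ^+ 2 + 2 * (V w * S w)))%:E)); last first.
  move=> w; rewrite inE cylinder_extend => -[/= -> Xw].
  by rewrite Xw// /V /S; congr EFin; case: (b != j) => /=; ring.
have mV : measurable_fun setT V by exact: mW.
have V0 w : 0 <= V w by exact: W_ge0.
have S0 w : 0 <= S w by exact: stopped_length_ge0.
have mSS : measurable_fun setT (fun w => S w ^+ 2) by exact/measurable_funX/mS.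
have mVS : measurable_fun setT (fun w => V w * S w).
  by apply: measurable_funM => //; exact: mS.
rewrite ge0_integralDZ//; last 5 first.
- exact: measurable_cylinder.
- exact: measurable_funX.
- by apply: measurable_funD => //; apply: measurable_funM.
- by move=> w; rewrite exprn_ge0.
- by move=> w; rewrite addr_ge0 ?exprn_ge0// mulr_ge0// mulr_ge0.
rewrite ge0_integralDZ//; last 3 first.
- exact: measurable_cylinder.
- by move=> w; rewrite exprn_ge0.
- by move=> w; rewrite mulr_ge0.
rewrite integral_weight2//; last exact: chain_events_cylinder.
rewrite IH (@integral_stopped_length V (W1 (x k) b))//; last first.
  by move=> A m a c cA km; apply: integral_weight_mul.
rewrite /extend ltnn -/(extend x k b) probability_cylinder_extend pE.
by rewrite -!EFinM -!EFinD; congr EFin; ring.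
Qed.

End walk.

(** * Moments and independence of the weights *)

Lemma mx_borel_entry (R : realType) n (a b : 'I_n) (B : set R) :
  measurable B -> mx_borel [set A : 'M[R]_n | B (A a b)].
Proof. by move=> mB; apply: sub_sigma_algebra; exists a, b, B. Qed.

(** The generators of [weight_events], named so that the sigma-algebra can carry a
    structure of measurable space. *)
Definition weight_generators (T : Type) (R : realType) (n : nat)
    (W : nat -> T -> 'M[R]_n) : set (set T) :=
  [set A | exists2 m : nat, (0 < m)%N & exists2 B, mx_borel B & A = W m @^-1` B].

Section weights.
Context d (T : measurableType d) (R : realType).
Variable Pr : probability T R.
Variables (n : nat) (e : rel 'I_n) (eps : R) (calW : T -> 'M[R]_n).
Variable W : nat -> T -> 'M[R]_n.
Hypothesis heps : 0 < eps.
Hypothesis hcalW : random_mx calW.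
Hypothesis hcalWval : forall w, weight_values e eps (calW w).
Hypothesis hWval : forall m w, (0 < m)%N -> weight_values e eps (W m w).
Hypothesis hiid : iid_weights Pr calW W.

Lemma weight_values_ge0 (A : 'M[R]_n) a b : weight_values e eps A -> 0 <= A a b.
Proof.
move=> [Ae An]; have [/Ae|/An -> //] := boolP (e a b).
by apply: le_trans; exact: ltW.
Qed.

Lemma weight_ge0 m w a b : (0 < m)%N -> 0 <= W m w a b.
Proof. by move=> m0; apply: weight_values_ge0; exact: hWval. Qed.

Lemma measurable_weight m : (0 < m)%N -> random_mx (W m).
Proof. by have [mW _ _] := hiid; exact: mW. Qed.

Lemma integral_weight_moment m r a b : (0 < m)%N ->
  (\int[Pr]_w (W m w a b ^+ r)%:E = weight_moment Pr calW r a b)%E.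
Proof.
move=> m0; have [mW sameW _] := hiid.
rewrite /weight_moment unlock; apply: eq_law_integral.
- by apply: measurable_funX; exact: mW.
- by apply: measurable_funX; exact: hcalW.
- by move=> w; rewrite exprn_ge0// weight_ge0.
- by move=> w; rewrite exprn_ge0//; exact: weight_values_ge0.
move=> A mA.
have mA' : measurable ((fun x : R => x ^+ r) @^-1` A).
  by rewrite -[X in measurable X]setTI; apply: exprn_measurable.
exact: (sameW m m0 _ (mx_borel_entry a b mA')).
Qed.

(** Finiteness is only given on edges; elsewhere the weight vanishes, and the
    exponent is positive. *)
Lemma weight_moment_fin r a b : (0 < r)%N ->
    (e a b -> (weight_moment Pr calW r a b < +oo)%E) ->
  weight_moment Pr calW r a b = (weight_moment_mx Pr calW r a b)%:E.
Proof.
move=> r0 fin; rewrite mxE fineK//.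
have [/fin eab|ne] := boolP (e a b).
  rewrite ge0_fin_numE// /weight_moment unlock; apply: integral_ge0 => w _.
  by rewrite lee_fin exprn_ge0//; exact: weight_values_ge0.
rewrite /weight_moment unlock (eq_integral (cst 0%E)) ?integral0// => w _.
by have [_ ->//] := hcalWval w; rewrite expr0n gtn_eqF.
Qed.

Lemma integral_weight_mul l m a b a' b' : (0 < l < m)%N ->
  (\int[Pr]_w (W l w a b * W m w a' b')%:E
   = \int[Pr]_w (W l w a b)%:E * \int[Pr]_w (W m w a' b')%:E)%E.
Proof.
move=> /andP[l0 lm]; have m0 := ltn_trans l0 lm.
apply: integral_mul_indep.
- exact: measurable_weight.
- exact: measurable_weight.
- by move=> w; exact: weight_ge0.
- by move=> w; exact: weight_ge0.
move=> A B mA mB; have [mW _ indep] := hiid.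
pose C k := if k == l then [set M : 'M[R]_n | A (M a b)]
            else [set M : 'M[R]_n | B (M a' b')].
have := indep [:: l; m] C.
rewrite /= inE (ltn_eqF lm) /= => /(_ isT).
rewrite big_cons big_seq1 /C eqxx (gtn_eqF lm).
have mWA : measurable ((fun w => W l w a b) @^-1` A).
  by rewrite -[X in measurable X]setTI; exact: mW.
have mWB : measurable ((fun w => W m w a' b') @^-1` B).
  by rewrite -[X in measurable X]setTI; exact: mW.
rewrite (_ : \bigcap_(k in _) _ =
   (fun w => W l w a b) @^-1` A `&` (fun w => W m w a' b') @^-1` B); last first.
  apply/seteqP; split => [w Ww|w [Aw Bw] k /=].
    split.
      by have := Ww l; rewrite /= eqxx mem_head; apply.
    by have := Ww m; rewrite /= (gtn_eqF lm) !inE eqxx orbT; apply.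
  by rewrite !inE => /orP[] /eqP ->; rewrite ?eqxx ?(gtn_eqF lm).
move=> AB; rewrite -(fineK (fin_num_measure Pr _ (measurableI _ _ mWA mWB))) AB.
- by rewrite EFinM !fineK//; exact: fin_num_measure.
- by move=> k; rewrite !inE => /orP[] /eqP ->.
- by move=> k; case: ifP => _; exact: mx_borel_entry.
Qed.

Variable X : nat -> T -> 'I_n.
Hypothesis mX : forall A, chain_events X A -> measurable A.
Hypothesis hind : independent_of_chain Pr X W.

Let WT := g_sigma_algebraType (weight_generators W).

Lemma weight_events_measurable A : weight_events W A -> measurable A.
Proof.
have [mW _ _] := hiid.
suff : weight_events W `<=` @measurable _ T by apply.
apply: smallest_sub; first exact: sigma_algebra_measurable.
move=> _ [m m0 [B mB ->]].
pose S := [set D : set 'M[R]_n | measurable (W m @^-1` D)].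
suff : mx_borel `<=` S by apply.
apply: smallest_sub.
  split; rewrite /S /=.
  - by rewrite preimage_set0.
  - by move=> D mD; rewrite setTD preimage_setC; exact: measurableC.
  - by move=> F mF; rewrite preimage_bigcup; exact: bigcupT_measurable.
move=> _ [a [b [D mD ->]]].
rewrite /S /= -[X in measurable X]setTI; exact: (mW m m0 a b).
Qed.

Lemma measurable_weight_gen m a b : (0 < m)%N ->
  measurable_fun [set: WT] (fun w : WT => W m w a b).
Proof.
move=> m0 _ B mB; rewrite setTI; apply: sub_sigma_algebra.
exists m => //; exists [set M : 'M[R]_n | B (M a b)] => //.
exact: mx_borel_entry.
Qed.

(** The expectation of a product, with the indicator of [A] as one factor. *)
Lemma integral_chain_weights (F : T -> R) (A : set T) : chain_events X A ->
    measurable_fun [set: WT] (F : WT -> R) -> (forall w, 0 <= F w) ->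
  (\int[Pr]_(w in A) (F w)%:E = (\int[Pr]_w (F w)%:E) * Pr A)%E.
Proof.
move=> cA mF F0.
have weF B : measurable B -> weight_events W (F @^-1` B).
  by move=> mB; rewrite -[F @^-1` B]setTI; exact: mF.
have mFT : measurable_fun [set: T] F.
  by move=> _ B mB; rewrite setTI; apply: weight_events_measurable; exact: weF.
have mA := mX cA.
rewrite integral_mkcond.
rewrite (eq_integral (fun w => (\1_A w * F w)%:E)); last first.
  by move=> w _; rewrite patchE indicE; case: ifPn; rewrite ?mul1r// mul0r.
rewrite integral_mul_indep//.
- by rewrite integral_indic// setIT muleC.
move=> B C mB mC; apply: hind; last exact: weF.
pose G := [set A | exists k j, A = [set w | X k w = j]].
suff : @measurable _ (g_sigma_algebraType G) (\1_A @^-1` B : set T) by [].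
rewrite preimage_indic; do 2 case: ifP => _ //; exact: measurableC.
Qed.

End weights.

(** * From truncated to full passages *)

Section passage.
Context d (T : measurableType d) (R : realType).
Variable Pr : probability T R.
Variables (n : nat) (P : 'M[R]_n) (i : 'I_n) (X : nat -> T -> 'I_n).
Hypothesis hX : markov_chain Pr P i X.
Variables (W : nat -> T -> 'M[R]_n) (j : 'I_n).
Hypothesis W_ge0 : forall m w a b, (0 < m)%N -> 0 <= W m w a b.
Hypothesis mW : forall m, (0 < m)%N -> random_mx (W m).

(** The infinite horizon is harmless: step [m + 1] belongs to the passage exactly
    when steps 1 to [m] have missed [j], which involves finitely many states even
    when [j] is never reached. *)
Lemma le_hat_tau m w :
  (m.+1%:R%:E <= hat_tau R X j w)%E = all (fun l => X l w != j) (iota 1 m).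
Proof.
apply/idP/allP => [le_tau l|avoid].
  rewrite mem_iota add1n => /andP[l0 lm]; apply/eqP => Xl.
  have : (m.+1%:R%:E <= l%:R%:E :> \bar R)%E.
    by apply: le_trans le_tau _; apply: ereal_inf_lbound; exists l.
  by rewrite lee_fin ler_nat leqNgt lm.
apply: le_ereal_inf_tmp => _ [l [l0 Xl] <-].
rewrite lee_fin ler_nat ltnNge; apply/negP => lm.
have := avoid l; rewrite mem_iota add1n l0 ltnS lm => /(_ isT).
by rewrite Xl eqxx.
Qed.

Lemma stopped_lengthE k N w :
  stopped_length X W j k N w =
  \sum_(0 <= m < N | all (fun l => X l w != j) (iota k.+1 m))
     W (k + m).+1 w (X (k + m)%N w) (X (k + m).+1 w).
Proof.
elim: N k => [|N IH] k /=; first by rewrite big_geq.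
rewrite big_mkcond big_nat_recl//= addn0 IH; congr (_ + _).
rewrite big_mkcond /= mulr_sumr; apply: eq_bigr => m _.
rewrite addSn addnS; case: (X k.+1 w != j) => /=; last by rewrite mul0r.
by rewrite mul1r.
Qed.

Lemma cvg_stopped_length w :
  (stopped_length X W j 0 N w)%:E @[N --> \oo] --> tau X W j w.
Proof.
pose u N := (\sum_(1 <= m < N | m%:R%:E <= hat_tau R X j w)
     (W m w (X m.-1 w) (X m w))%:E)%E.
have u_cvg : u N @[N --> \oo] --> tau X W j w.
  by apply: is_cvg_nneseries_cond => m m0 _; rewrite lee_fin W_ge0.
rewrite -(cvg_shiftS u) in u_cvg.
apply: cvg_trans u_cvg; apply: near_eq_cvg; near=> N.
rewrite stopped_lengthE /= /u big_add1 /= -sumEFin.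
by apply: eq_bigl => m; rewrite le_hat_tau.
Unshelve. all: by end_near. Qed.

Lemma cvg_stopped_lengthX r w :
  (stopped_length X W j 0 N w ^+ r)%:E @[N --> \oo] --> (tau X W j w ^+ r)%E.
Proof.
have tau_ge0 : (0 <= tau X W j w)%E.
  by apply: nneseries_ge0 => m m0 _; rewrite lee_fin W_ge0.
elim: r => [|r IH].
  by under eq_fun do rewrite expr0; exact: cvg_cst.
rewrite expeS; under eq_fun do rewrite exprS EFinM.
apply: cvgeM => //; last exact: cvg_stopped_length.
have [finite|infinite] := boolP (tau X W j w \is a fin_num).
  by rewrite mule_def_fin// fin_numX.
rewrite mule_def_infty_neq0//.
by rewrite gt_eqF// expe_gt0// lt0e tau_ge0 andbT; apply: contraNneq infinite => ->.
Qed.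

Lemma nondecreasing_stopped_length k w :
  nondecreasing_seq (fun N => stopped_length X W j k N w).
Proof.
apply/nondecreasing_seqP => N; elim: N k => [|N IH] k.
  exact: (stopped_length_ge0 X j W_ge0 k 1).
by rewrite /= lerD2l ler_wpM2l//; exact: IH.
Qed.

(** Monotone convergence; the start [X 0 = i], of probability 1, lets the integral
    over the cylinder stand for the full expectation. *)
Lemma cvg_passage_moment r (v : nat -> R) :
    (forall N, \int[Pr]_(w in cylinder X (cst i) 0)
       (stopped_length X W j 0 N w ^+ r)%:E
     = (v N)%:E * Pr (cylinder X (cst i) 0))%E ->
  (v N)%:E @[N --> \oo] --> (\int[Pr]_w (tau X W j w ^+ r))%E.
Proof.
move=> vE; have [mX X0 _] := hX.
have mS := measurable_stopped_length hX j mW.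
have S_ge0 := stopped_length_ge0 X j W_ge0.
have cyl0 : cylinder X (cst i) 0 = [set w | X 0%N w = i].
  apply/seteqP; split=> [w Xw|w Xw l]; first exact: Xw.
  by rewrite leqn0 => /eqP ->.
have -> : (fun N => (v N)%:E) =
    (fun N => \int[Pr]_w (stopped_length X W j 0 N w ^+ r)%:E)%E.
  apply/funext => N.
  have := vE N; rewrite cyl0 X0 mule1 => <-.
  rewrite [RHS](@ge0_negligible_integral _ _ _ _ _ (~` [set w | X 0%N w = i]))//.
  - by rewrite setTD setCK.
  - exact: measurableC.
  - by apply/measurable_EFinP; apply: measurable_funX; exact: mS.
  - by move=> w _; rewrite lee_fin exprn_ge0.
  - by have := probability_setC Pr (mX 0%N i); rewrite X0 subee.
rewrite (eq_integral (fun w =>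
   limn (fun N => (stopped_length X W j 0 N w ^+ r)%:E))); last first.
  by move=> w _; apply/esym/cvg_lim => //; exact: cvg_stopped_lengthX.
apply: cvg_monotone_convergence => //.
- by move=> N; apply/measurable_EFinP; apply: measurable_funX; exact: mS.
- by move=> N w _; rewrite lee_fin exprn_ge0.
- move=> w _ N N' NN'; rewrite lee_fin lerXn2r ?nnegrE//.
  exact: nondecreasing_stopped_length.
Qed.

End passage.

(** * Iteration of the taboo operator *)

Section taboo.
Variables (R : realType) (n : nat) (P : 'M[R]_n) (j : 'I_n).
Hypothesis P_ge0 : forall a b, 0 <= P a b.
Hypothesis P_sum : forall a, \sum_b P a b = 1.
Hypothesis hirr : irreducible_mx P.

Definition taboo (y : 'I_n -> R) (a : 'I_n) : R :=
  \sum_b P a b * ((b != j)%:R * y b).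

Lemma le_taboo y z : (forall b, y b <= z b) -> forall a, taboo y a <= taboo z a.
Proof. by move=> yz a; apply: ler_sum => b _; rewrite !ler_wpM2l. Qed.

(** The probability that the walk from [a] misses [j] during the next [m] steps. *)
Let survival m := iter m taboo (fun=> 1).

Lemma survival_ge0 m a : 0 <= survival m a.
Proof.
elim: m a => [|m IH] a //=.
by apply: sumr_ge0 => b _; rewrite !mulr_ge0//; exact: IH.
Qed.

Lemma survivalS_le m a : survival m.+1 a <= survival m a.
Proof.
elim: m a => [|m IH] a /=; last exact: le_taboo.
rewrite -[leRHS](P_sum a); apply: ler_sum => b _.
by rewrite -[leRHS]mulr1 ler_wpM2l// mulr1; case: (b != j).
Qed.

Lemma survival_le1 m a : survival m a <= 1.
Proof.
by elim: m a => [|m IH] a //; apply: le_trans (IH a); exact: survivalS_le.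
Qed.

(** A walk that surely misses [j] for [m + 1] steps moves, with probability 1, to
    states other than [j] from which it surely misses [j] for [m] steps. *)
Lemma survival_eq1 m a : survival m a = 1 ->
  forall k, (0 < k <= m)%N -> (P ^+ k) a j = 0.
Proof.
elim: m a => [|m IH] a surv [//|k] /= km; first by rewrite ltn0 in km.
(* A vanishing sum of nonnegative terms has only zero terms. *)
have step b : P a b * (1 - (b != j)%:R * survival m b) = 0.
  have /psumr_eq0P : \sum_b P a b * (1 - (b != j)%:R * survival m b) = 0.
    under eq_bigr do rewrite mulrBr mulr1.
    by rewrite sumrB P_sum [X in _ - X]surv subrr.
  apply=> // c _; rewrite mulr_ge0// subr_ge0.
  by case: (c != j); rewrite ?mul0r// mul1r survival_le1.
case: k km => [|k] km.
  by have := step j; rewrite expr1 eqxx mul0r subr0 mulr1.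
rewrite exprS mxE big1// => b _.
have /eqP := step b; rewrite mulf_eq0 => /orP[/eqP ->|]; first by rewrite mul0r.
have [->|bj] := eqVneq b j; first by rewrite mul0r subr0 oner_eq0.
rewrite mul1r subr_eq0 => /eqP/esym surv_b.
by rewrite IH ?mulr0.
Qed.

Lemma survival_lt1 : exists K, forall a, survival K a < 1.
Proof.
have /choice[k kP] : forall a, exists k, survival k a < 1.
  move=> a; have [k k0 Pk] := hirr a j; exists k.
  rewrite lt_neqAle survival_le1 andbT; apply/eqP => surv.
  by move: Pk; rewrite (survival_eq1 surv) ?k0 ?leqnn// ltxx.
exists (\max_a k a)%N => a; apply: le_lt_trans (kP a).
have : (k a <= \max_a k a)%N by exact: leq_bigmax.
have /nonincreasing_seqP := fun m => survivalS_le m a.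
exact.
Qed.

(** Let [s] be the sum of the survival probabilities up to time [K]. The operator
    shifts the sum by one, so [s - taboo s] telescopes to [1 - survival K], which
    is bounded away from 0; a large multiple of [s] is as wanted. *)
Lemma taboo_supersolution (h : 'I_n -> R) : (forall a, 0 <= h a) ->
  exists2 y, forall a, 0 <= y a & forall a, h a + taboo y a <= y a.
Proof.
move=> h0; have [K surv] := survival_lt1.
pose c := \sum_a h a / (1 - survival K a).
have quo a : 0 <= h a / (1 - survival K a).
  by rewrite divr_ge0// subr_ge0 survival_le1.
have c0 : 0 <= c by exact: sumr_ge0.
exists (fun a => c * \sum_(0 <= m < K) survival m a) => a.
  by rewrite mulr_ge0// sumr_ge0// => m _; exact: survival_ge0.
have -> : taboo (fun a => c * \sum_(0 <= m < K) survival m a) a =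
    c * \sum_(0 <= m < K) survival m.+1 a.
  rewrite /= /taboo exchange_big /= mulr_sumr; apply: eq_bigr => b _.
  rewrite !mulr_sumr; apply: eq_bigr => m _; ring.
rewrite -lerBrDr -mulrBr -sumrB.
under eq_bigr do rewrite -opprB.
rewrite sumrN telescope_sumr// opprB {1}/survival /=.
have gap : 0 < 1 - survival K a by rewrite subr_gt0.
rewrite -ler_pdivrMr//.
by rewrite /c (bigD1 a)//= lerDl sumr_ge0.
Qed.

(** The iterates increase and stay below a supersolution for [H]. The source term
    depends on [N] because the recurrence for second moments contains the
    truncated first moments. *)
Lemma taboo_iteration_cvg (h v : nat -> 'I_n -> R) (H : 'I_n -> R) :
    (forall a, v 0%N a = 0) ->
    (forall N a, v N.+1 a = h N a + taboo (v N) a) ->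
    (forall N a, 0 <= h N a) -> (forall N a, h N a <= h N.+1 a) ->
    (forall a, h N a @[N --> \oo] --> H a) ->
  exists2 y, forall a, v N a @[N --> \oo] --> y a &
    forall a, y a = H a + taboo y a.
Proof.
move=> v0 vS h0 h_nd hH.
have hleH N a : h N a <= H a.
  rewrite -(cvg_lim (@Rhausdorff R) (hH a)).
  apply: nondecreasing_cvgn_le; last by apply/cvg_ex; exists (H a).
  by apply/nondecreasing_seqP.
have [z z0 zsup] := taboo_supersolution (fun a => le_trans (h0 0%N a) (hleH 0%N a)).
have v_le N a : v N a <= z a.
  elim: N a => [|N IH] a; first by rewrite v0.
  by rewrite vS; apply: le_trans (zsup a); rewrite lerD// le_taboo.
have taboo_ge0 y a : (forall b, 0 <= y b) -> 0 <= taboo y a.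
  by move=> y0; apply: sumr_ge0 => b _; rewrite !mulr_ge0.
have v_nd N a : v N a <= v N.+1 a.
  elim: N a => [|N IH] a; last by rewrite [leLHS]vS [leRHS]vS lerD// le_taboo.
  by rewrite v0 vS addr_ge0// taboo_ge0// => b; rewrite v0.
pose y a := limn (fun N => v N a).
have v_cvg a : v N a @[N --> \oo] --> y a.
  apply: nondecreasing_is_cvgn; first by apply/nondecreasing_seqP.
  by exists (z a) => _ [N _ <-].
exists y => // a.
have shifted : v N.+1 a @[N --> \oo] --> y a.
  by rewrite (cvg_shiftS (fun N => v N a)); exact: v_cvg.
have rhs : v N.+1 a @[N --> \oo] --> H a + taboo y a.
  under eq_fun do rewrite vS.
  apply: cvgD => //; apply: cvg_big => [|b _]; first exact: add_continuous.
  by do 2 (apply: cvgMr).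
by rewrite -(cvg_lim (@Rhausdorff R) shifted) (cvg_lim (@Rhausdorff R) rhs).
Qed.
End taboo.

(** * The fundamental matrix *)

Section fundamental.
Variables (R : realType) (n : nat) (P : 'M[R]_n) (ppi : 'rV[R]_n).
Hypothesis P_ge0 : forall a b, 0 <= P a b.
Hypothesis P_sum : forall a, \sum_b P a b = 1.
Hypothesis hirr : irreducible_mx P.
Hypothesis hpi : stationary P ppi.

Lemma expmx_ge0 k a b : 0 <= (P ^+ k) a b.
Proof.
elim: k a b => [|k IH] a b; first by rewrite expr0 mxE; case: (a == b).
by rewrite exprS mxE sumr_ge0// => c _; rewrite mulr_ge0.
Qed.

Lemma mulmx_ones : P *m ones = ones.
Proof.
apply/colP => a; rewrite !mxE -(P_sum a).
by apply: eq_bigr => b _; rewrite mxE mulr1.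
Qed.

Lemma expmx_fixed (x : 'cV[R]_n) k : P *m x = x -> P ^+ k *m x = x.
Proof.
move=> Px; elim: k => [|k IH]; first exact: mul1mx.
by rewrite exprS -mulmxA IH.
Qed.

Lemma stationary_neq0 j : ppi 0 j != 0.
Proof.
have [pi_ge0 pi_sum piP] := hpi.
have piPk k : ppi *m P ^+ k = ppi.
  elim: k => [|k IH]; first exact: mulmx1.
  by rewrite exprS mulmxA piP.
apply/eqP => pij0.
have pi0 a : ppi 0 a = 0.
  have [k _ Pk] := hirr a j.
  have := congr1 (fun x : 'rV_n => x 0 j) (piPk k).
  rewrite mxE pij0 => /psumr_eq0P.
  move=> /(_ (fun b _ => mulr_ge0 (pi_ge0 b) (expmx_ge0 k b j))) /(_ a isT) /eqP.
  by rewrite mulf_eq0 (gt_eqF Pk) orbF => /eqP.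
by move: pi_sum; rewrite big1// => /esym/eqP; rewrite oner_eq0.
Qed.

(** Maximum principle: [x] averages to its maximum around the point [m] where it is
    attained, so it equals the maximum at every point reachable from [m]. *)
Lemma harmonic_const (x : 'cV[R]_n) a b : P *m x = x -> x a 0 = x b 0.
Proof.
move=> Px.
suff [m xm] : exists m, forall c, x c 0 = x m 0 by rewrite !xm.
have [m _ mmax] := @arg_maxP _ _ _ a xpredT (fun c => x c 0) isT.
exists m => c; have [k _ Pk] := hirr m c.
have row_sum : \sum_l (P ^+ k) m l = 1.
  have /(congr1 (fun y : 'cV_n => y m 0)) := expmx_fixed k mulmx_ones.
  by rewrite !mxE => <-; apply: eq_bigr => l _; rewrite mxE mulr1.
have avg : \sum_l (P ^+ k) m l * (x m 0 - x l 0) = 0.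
  under eq_bigr do rewrite mulrBr.
  rewrite sumrB -mulr_suml row_sum mul1r.
  have /(congr1 (fun y : 'cV_n => y m 0)) := expmx_fixed k Px.
  by rewrite mxE => ->; rewrite subrr.
have gap_ge0 l : true -> 0 <= (P ^+ k) m l * (x m 0 - x l 0).
  by move=> _; rewrite mulr_ge0 ?expmx_ge0// subr_ge0; exact: mmax.
have /(_ c isT)/eqP := psumr_eq0P gap_ge0 avg.
by rewrite mulf_eq0 (gt_eqF Pk) /= subr_eq0 => /eqP.
Qed.

Lemma stationary_ones : ppi *m ones = 1%:M.
Proof.
have [_ pi_sum _] := hpi.
apply/matrixP => a b; rewrite !ord1 !mxE /= -pi_sum.
by apply: eq_bigr => c _; rewrite mxE mulr1.
Qed.

Let Pi := limit_mx ppi.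

Lemma stationary_fundamental : ppi *m (1%:M - P + Pi) = ppi.
Proof.
have [_ _ piP] := hpi.
by rewrite mulmxDr mulmxBr mulmx1 piP subrr add0r mulmxA stationary_ones mul1mx.
Qed.

(** A vector in the kernel is annihilated by the stationary law, by
    [stationary_fundamental]; so it is harmonic, hence constant, and its constant
    is its mean, 0. *)
Lemma fundamental_unit : 1%:M - P + Pi \in unitmx.
Proof.
have ker (x : 'cV[R]_n) : (1%:M - P + Pi) *m x = 0 -> x = 0.
  move=> Ax; have [_ pi_sum _] := hpi.
  have pix : ppi *m x = 0 by rewrite -stationary_fundamental -mulmxA Ax mulmx0.
  have Px : P *m x = x.
    apply/eqP; rewrite eq_sym -subr_eq0 -{1}[x]mul1mx -mulmxBl.
    by rewrite -Ax mulmxDl /Pi /limit_mx -mulmxA pix mulmx0 addr0.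
  apply/colP => a; rewrite [RHS]mxE -[LHS]mul1r -pi_sum mulr_suml.
  have /(congr1 (fun y : 'rV[R]_1 => y 0 0)) := pix.
  rewrite !mxE => pixE; rewrite -[RHS]pixE.
  by apply: eq_bigr => b _; rewrite (harmonic_const a b Px).
rewrite -unitmx_tr -row_free_unit; apply: inj_row_free => v vA.
rewrite -[v]trmxK (ker v^T) ?trmx0//.
by apply: (can_inj trmxK); rewrite trmx_mul trmxK vA trmx0.
Qed.

Let Z := fundamental_mx P ppi.

Lemma fundamental_mul : Z *m (1%:M - P) = 1%:M - Pi.
Proof.
have ZA : Z *m (1%:M - P + Pi) = 1%:M by exact: (mulVmx fundamental_unit).
have APi : (1%:M - P + Pi) *m Pi = Pi.
  rewrite mulmxDl mulmxBl mul1mx /Pi /limit_mx (mulmxA P) mulmx_ones subrr add0r.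
  by rewrite -mulmxA (mulmxA ppi) stationary_ones mul1mx.
have ZPi : Z *m Pi = Pi by rewrite -[in LHS]APi mulmxA ZA mul1mx.
by rewrite -[1%:M - P](addrK Pi) mulmxBr ZA ZPi.
Qed.

Variables A Y : 'M[R]_n.
Hypothesis YE : Y = A + P *m (Y - dg Y).

(** By stationarity, applying [ppi] to [YE] cancels [ppi *m Y]. *)
Lemma first_step_diag i : Y i i = (ppi *m A) 0 i / ppi 0 i.
Proof.
have [_ _ piP] := hpi.
have E : ppi *m A = ppi *m dg Y.
  have := congr1 (mulmx ppi) YE.
  rewrite mulmxDr mulmxA piP mulmxBr => E.
  apply/eqP; rewrite -subr_eq0; apply/eqP.
  by apply: (addrI (ppi *m Y)); rewrite addr0 {2}E addrCA.
rewrite E mxE (bigD1 i)//= big1 => [|b bi].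
  by rewrite mxE eqxx addr0 mulrAC mulfV ?mul1r// stationary_neq0.
by rewrite mxE (negbTE bi) mulr0.
Qed.

(** [Z] inverts [1%:M - P] up to [Pi], and a multiple of [Pi] has constant
    columns. *)
Lemma first_step_solution :
  let J : 'M[R]_n := ones *m ones^T in
  Y = Z *m A - J *m dg (Z *m A) + (1%:M - Z + J *m dg Z) *m dg Y.
Proof.
move=> J.
have addE (B C : 'M[R]_n) a b : (B + C) a b = B a b + C a b by rewrite mxE.
have subE (B C : 'M[R]_n) a b : (B - C) a b = B a b - C a b by rewrite !mxE.
have JdgE B a b : (J *m dg B) a b = B b b.
  rewrite mxE (bigD1 b)//= big1 => [|c cb]; last first.
    by rewrite [dg B c b]mxE (negbTE cb) mulr0.
  by rewrite [dg B b b]mxE eqxx !mxE big_ord1 !mxE !mul1r addr0.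
have mul_dgE B a b : (B *m dg Y) a b = B a b * Y b b.
  rewrite mxE (bigD1 b)//= big1 => [|c cb]; last first.
    by rewrite [dg Y c b]mxE (negbTE cb) mulr0.
  by rewrite [dg Y b b]mxE eqxx addr0.
have ZP : Z *m P = Z - (1%:M - Pi).
  by rewrite -fundamental_mul mulmxBr mulmx1 opprB addrCA subrr addr0.
have E : Y = Pi *m (Y - dg Y) + Z *m A + (1%:M - Z) *m dg Y.
  have := congr1 (mulmx Z) YE.
  rewrite mulmxDr mulmxA ZP !mulmxBl !mulmxBr !mul1mx.
  move: (Z *m Y) (Z *m A) (Z *m dg Y) (Pi *m Y) (Pi *m dg Y).
  move=> ZY ZA ZD PiY PiD /matrixP YE'; apply/matrixP => a b.
  by have := YE' a b; rewrite !mxE; lra.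
pose r b := (ppi *m (Y - dg Y)) 0 b.
have Er a b : Y a b = r b + (Z *m A) a b + (1%:M - Z) a b * Y b b.
  rewrite -mul_dgE [LHS](congr1 (fun M : 'M[R]_n => M a b) E) !addE.
  congr (_ + _ + _).
  by rewrite /Pi /limit_mx -mulmxA mxE big_ord1 mxE mul1r.
apply/matrixP => a b.
(* The row [r] is read off the diagonal of the identity [Er]. *)
have Erb := Er b b; rewrite !subE [1%:M b b]mxE eqxx mulr1n in Erb.
rewrite addE mul_dgE (addE _ (J *m dg Z)) (subE _ (J *m _)) !JdgE (Er a b).
rewrite !subE; lra.
Qed.
End fundamental.

(** * First-step equations for the passage moments *)

Section first_step.
Context d (T : measurableType d) (R : realType).
Variable Pr : probability T R.
Variables (n : nat) (e : rel 'I_n) (P : 'M[R]_n) (eps : R) (calW : T -> 'M[R]_n).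
Variables (X : 'I_n -> nat -> T -> 'I_n) (W : nat -> T -> 'M[R]_n).
Hypothesis P_ge0 : forall a b, 0 <= P a b.
Hypothesis P_sum : forall a, \sum_b P a b = 1.
Hypothesis hirr : irreducible_mx P.
Hypothesis heps : 0 < eps.
Hypothesis hcalW : random_mx calW.
Hypothesis hcalWval : forall w, weight_values e eps (calW w).
Hypothesis hW1 : forall i j, e i j -> (weight_moment Pr calW 1 i j < +oo)%E.
Hypothesis hW2 : forall i j, e i j -> (weight_moment Pr calW 2 i j < +oo)%E.
Hypothesis hX : forall i, markov_chain Pr P i (X i).
Hypothesis hWval : forall m w, (0 < m)%N -> weight_values e eps (W m w).
Hypothesis hiid : iid_weights Pr calW W.
Hypothesis hind : forall i, independent_of_chain Pr (X i) W.

Let W1 := weight_moment_mx Pr calW 1.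
Let W2 := weight_moment_mx Pr calW 2.

Let integral_chain i :=
  integral_chain_weights hiid (measurable_chain_events (hX i)) (@hind i).

Lemma weight_moment_mx_ge0 r a b : 0 <= weight_moment_mx Pr calW r a b.
Proof.
rewrite mxE fine_ge0// /weight_moment unlock; apply: integral_ge0 => w _.
rewrite lee_fin exprn_ge0//; exact: (weight_values_ge0 heps).
Qed.

(** The witnesses are limits of the truncated moments. That they are real numbers
    is part of the claim: in extended reals the equation of [y2] could be the
    empty statement that both sides are infinite. *)
Lemma passage_moments_first_step j :
  exists y1 y2 : 'I_n -> R,
  [/\ forall i, passage_moment Pr X W 1 i j = (y1 i)%:E,
      forall i, passage_moment Pr X W 2 i j = (y2 i)%:E &
      forall i, y2 i = \sum_b P i b * (W2 i b
                         + (b != j)%:R * (y2 b + 2 * (W1 i b * y1 b)))].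
Proof.
have W_ge0 := weight_ge0 heps hWval.
have mW := measurable_weight hiid.
have meanW m a b : (0 < m)%N -> (\int[Pr]_w (W m w a b)%:E = (W1 a b)%:E)%E.
  move=> m0; rewrite -(weight_moment_fin heps hcalWval)//; last exact: hW1.
  by rewrite -(integral_weight_moment heps hcalW hcalWval hWval hiid _ _ _ m0).
have W1E i A m a b : chain_events (X i) A -> (0 < m)%N ->
    (\int[Pr]_(w in A) (W m w a b)%:E = (W1 a b)%:E * Pr A)%E.
  move=> cA m0; rewrite (integral_chain cA)//; last first.
  - by move=> w; exact: W_ge0.
  - exact: measurable_weight_gen.
  by rewrite meanW.
have W2E i A m a b : chain_events (X i) A -> (0 < m)%N ->
    (\int[Pr]_(w in A) (W m w a b ^+ 2)%:E = (W2 a b)%:E * Pr A)%E.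
  move=> cA m0; rewrite (integral_chain cA)//; last first.
  - by move=> w; rewrite exprn_ge0// W_ge0.
  - by apply: measurable_funX; exact: measurable_weight_gen.
  congr (_ * _)%E; rewrite -(weight_moment_fin heps hcalWval)//; last exact: hW2.
  by rewrite -(integral_weight_moment heps hcalW hcalWval hWval hiid _ _ _ m0).
have W11E i A l m a b a' b' : chain_events (X i) A -> (0 < l < m)%N ->
    (\int[Pr]_(w in A) (W l w a b * W m w a' b')%:E
     = (W1 a b * W1 a' b')%:E * Pr A)%E.
  move=> cA lm; have /andP[l0 l_m] := lm; have m0 := ltn_trans l0 l_m.
  rewrite (integral_chain cA)//; last first.
  - by move=> w; rewrite mulr_ge0// W_ge0.
  - by apply: measurable_funM; exact: measurable_weight_gen.
  by rewrite (integral_weight_mul heps hWval hiid)// !meanW.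
have cvg1 i : (mean_stopped P W1 j N i)%:E @[N --> \oo]
    --> passage_moment Pr X W 1 i j.
  apply: (cvg_passage_moment (hX i) W_ge0 mW) => N.
  exact: (integral_stopped_length1 (hX i) j W_ge0 mW (W1E i) 0 N (cst i)).
have cvg2 i : (mean2_stopped P W1 W2 j N i)%:E @[N --> \oo]
    --> passage_moment Pr X W 2 i j.
  apply: (cvg_passage_moment (hX i) W_ge0 mW) => N.
  exact: (integral_stopped_length2 (hX i) j W_ge0 mW (W2E i) (W11E i) 0 N (cst i)).
have W1_ge0 a b : 0 <= W1 a b by exact: weight_moment_mx_ge0.
have W2_ge0 a b : 0 <= W2 a b by exact: weight_moment_mx_ge0.
have [y1 y1_cvg y1E] : exists2 y,
    forall a, mean_stopped P W1 j N a @[N --> \oo] --> y a &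
    forall a, y a = \sum_b P a b * W1 a b + taboo P j y a.
  apply: (taboo_iteration_cvg P_ge0 P_sum hirr
    (h := fun _ a => \sum_b P a b * W1 a b)) => //.
  - move=> N a /=; rewrite /taboo -big_split /=; apply: eq_bigr => b _.
    by rewrite mulrDr.
  - by move=> _ a; apply: sumr_ge0 => b _; rewrite mulr_ge0.
  - by move=> a; exact: cvg_cst.
have y1_nd a : nondecreasing_seq (fun N => mean_stopped P W1 j N a).
  apply/nondecreasing_seqP => N; elim: N a => [|N IH] a.
    by apply: sumr_ge0 => b _; rewrite mulr_ge0// addr_ge0//= mulr0.
  by apply: ler_sum => b _; rewrite ler_wpM2l// lerD2l ler_wpM2l// IH.
have m1_ge0 N a : 0 <= mean_stopped P W1 j N a by exact: (y1_nd a 0%N N).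
(* The source term of the second moments, as a function of the first moment. *)
pose c a b y := P a b * (W2 a b + (b != j)%:R * (2 * (W1 a b * y))).
have c_le a b y z : y <= z -> c a b y <= c a b z.
  by move=> yz; rewrite ler_wpM2l// lerD2l ler_wpM2l// ler_wpM2l// ler_wpM2l.
have [y2 y2_cvg y2E] : exists2 y,
    forall a, mean2_stopped P W1 W2 j N a @[N --> \oo] --> y a &
    forall a, y a = \sum_b c a b (y1 b) + taboo P j y a.
  apply: (taboo_iteration_cvg P_ge0 P_sum hirr
    (h := fun N a => \sum_b c a b (mean_stopped P W1 j N b))) => //.
  - move=> N a /=; rewrite /taboo -big_split /=; apply: eq_bigr => b _.
    by rewrite /c; ring.
  - move=> N a; apply: sumr_ge0 => b _.
    by rewrite mulr_ge0// addr_ge0// !mulr_ge0.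
  - by move=> N a; apply: ler_sum => b _; apply: c_le; exact: y1_nd.
  - move=> a; apply: cvg_big => [|b _]; first exact: add_continuous.
    apply: cvgMr; apply: cvgD; first exact: cvg_cst.
    by do 3 (apply: cvgMr).
exists y1, y2; split=> i.
- apply: (cvg_unique _ (cvg1 i)) => //.
  by apply: cvg_EFin; [exact: nearW|exact: y1_cvg].
- apply: (cvg_unique _ (cvg2 i)) => //.
  by apply: cvg_EFin; [exact: nearW|exact: y2_cvg].
- rewrite [LHS]y2E /taboo -big_split; apply: eq_bigr => b _.
  by rewrite /c /=; ring.
Qed.

End first_step.

Theorem theorem2 (R : realType) (d : measure_display) (T : measurableType d)
    (Pr : probability T R) (n : nat)
    (* the weighted Markovian graph *)
    (e : rel 'I_n) (P : 'M[R]_n) (eps : R) (calW : T -> 'M[R]_n)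
    (hconn : strongly_connected e)
    (hP : markovian e P)
    (hirr : irreducible_mx P)
    (haper : aperiodic_mx P)
    (heps : 0 < eps)
    (hcalW : random_mx calW)
    (hcalWval : forall w, weight_values e eps (calW w))
    (* assumption (A) *)
    (ppi : 'rV[R]_n)
    (hpi : stationary P ppi)
    (hpi_unique : forall p : 'rV[R]_n, stationary P p -> p = ppi)
    (hW1 : forall i j, e i j -> (weight_moment Pr calW 1 i j < +oo)%E)
    (hW2 : forall i j, e i j -> (weight_moment Pr calW 2 i j < +oo)%E)
    (* the chains, [X i] being started at [i], and the successive weights *)
    (X : 'I_n -> nat -> T -> 'I_n) (W : nat -> T -> 'M[R]_n)
    (hX : forall i, markov_chain Pr P i (X i))
    (hWval : forall m w, (0 < m)%N -> weight_values e eps (W m w))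
    (* assumption (A star) *)
    (hiid : iid_weights Pr calW W)
    (hind : forall i, independent_of_chain Pr (X i) W) :
  let PW := hadamard P (weight_moment_mx Pr calW 1) in
  let PW2 := hadamard P (weight_moment_mx Pr calW 2) in
  let M := passage_moment_mx Pr X W 1 in
  let M2 := passage_moment_mx Pr X W 2 in
  let Z := fundamental_mx P ppi in
  let J : 'M[R]_n := ones *m ones^T in
  [/\ (* the entries of M and M2 are finite, i.e. equal to the expectations *)
      forall i j, passage_moment Pr X W 1 i j = (M i j)%:E /\
                  passage_moment Pr X W 2 i j = (M2 i j)%:E,
      forall i, M2 i i =
        ((ppi *m PW2 *m ones) 0 0 + (2 *: (ppi *m PW *m (M - dg M))) 0 i)
        / ppi 0 i
    & M2 = Z *m PW2 *m ones *m ones^T - J *m dg (Z *m PW2 *m ones *m ones^T)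
           + 2 *: (Z *m PW *m (M - dg M) - J *m dg (Z *m PW *m (M - dg M)))
           + (1%:M - Z + J *m dg Z) *m dg M2].
Proof.
move=> PW PW2 M M2 Z J.
have [P_edge P_nonedge P_sum] := hP.
have P_ge0 a b : 0 <= P a b.
  by have [/P_edge|/P_nonedge ->] := boolP (e a b).
have /choice[y1 /choice[y2 yP]] := passage_moments_first_step P_ge0 P_sum hirr
  heps hcalW hcalWval hW1 hW2 hX hWval hiid hind.
have ME i j : M i j = y1 j i by have [m1 _ _] := yP j; rewrite mxE m1.
have M2E i j : M2 i j = y2 j i by have [_ m2 _] := yP j; rewrite mxE m2.
pose A := PW2 *m ones *m ones^T + 2 *: (PW *m (M - dg M)).
have onesE m (B : 'M[R]_(m, n)) i j :
    (B *m ones *m (ones : 'cV[R]_n)^T) i j = (B *m ones) i 0.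
  by rewrite mxE big_ord1 !mxE mulr1.
have M2_step : M2 = A + P *m (M2 - dg M2).
  apply/matrixP => i j; have [_ _ step] := yP j.
  rewrite M2E step /A [RHS]mxE [X in X + _]mxE onesE [X in _ + X + _]mxE.
  rewrite [(PW2 *m _) i 0]mxE [(PW *m _) i j]mxE [(P *m _) i j]mxE.
  rewrite mulr_sumr -!big_split /=; apply: eq_bigr => b _.
  have minus_dg (B : 'M[R]_n) : (B - dg B) b j = (b != j)%:R * B b j.
    by rewrite !mxE; case: eqVneq => _; rewrite ?subrr ?mul0r// subr0 mul1r.
  rewrite !minus_dg ME M2E [PW2 i b]mxE [PW i b]mxE [ones b 0]mxE.
  by ring.
split.
- by move=> i j; have [m1 m2 _] := yP j; rewrite m1 m2 ME M2E.
- move=> i.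
  rewrite (first_step_diag P_ge0 hirr hpi M2_step) /A mulmxDr [in LHS]mxE.
  by rewrite !mulmxA onesE -scalemxAr mulmxA.
- have dg_lin (B C : 'M[R]_n) : dg (B + 2 *: C) = dg B + 2 *: dg C.
    by apply/matrixP => i j; rewrite !mxE; case: (i == j); rewrite ?mulr0 ?addr0.
  rewrite {1}(first_step_solution P_ge0 P_sum hirr hpi M2_step) -/J -/Z.
  congr (_ + _); rewrite /A mulmxDr -scalemxAr !mulmxA.
  rewrite dg_lin (mulmxDr J) -(scalemxAr _ J).
  by rewrite scalerBr opprD addrACA.
Qed.
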